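(* Let $p_r(n)$ denote Ramanujan's general partition function, defined for integers $n\ge 0$ and nonzero integers $r$ by $\sum_{n=0}^\infty p_r(n)q^n=\frac{1}{(q;q)_\infty^r}$ for $|q|<1$, where $(q;q)_\infty=\prod_{k=1}^\infty(1-q^{k})$. For any integer $\lambda$, every integer $n\ge 0$, and $\ell\in\{2,3,4\}$, we have $p_{-(5\lambda+3)}(5n+\ell)\equiv 0\pmod 5$. *)

(* Defs.v *)
From HB Require Import structures.
From mathcomp Require Import all_boot all_order all_algebra.
From mathcomp Require Import complex.
From mathcomp Require Import all_classical all_reals all_analysis.
Import Order.TTheory GRing.Theory Num.Theory.
Import numFieldNormedType.Exports.

Set Implicit Arguments.
Unset Strict Implicit.
Unset Printing Implicit Defensive.

Local Open Scope classical_set_scope.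
Local Open Scope complex_scope.
Local Open Scope ring_scope.

(* Gives R[i] the topology of the complex modulus, which the library only puts
   on R[i]^o. *)
HB.instance Definition _ (R : realType) := NormedModule.copy R[i] R[i]^o.

(* (q; q)_oo; the limit exists for `|q| < 1, and is then nonzero. *)
Definition qpochhammer (R : realType) (q : R[i]) : R[i] :=
  limn (fun N : nat => \prod_(1 <= k < N.+1) (1 - q ^+ k)).

(* sum_n p(n) q^n = 1 / (q; q)_oo ^ r on the open unit disc of the complex plane.
   By uniqueness of power series coefficients this determines p from r. *)
Definition partition_genfun (R : realType) (r : int) (p : nat -> R[i]) : Prop :=
  forall q : R[i], `|q| < 1 ->
    series (fun n : nat => p n * q ^+ n) @ \oo --> (qpochhammer q ^ r)^-1.

(* Main.v *)
Require Import Defs.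
From mathcomp Require Import all_boot all_order all_algebra.
From mathcomp Require Import complex.
From mathcomp Require Import all_classical all_reals all_analysis.
From mathcomp Require Import ring lra zify.
Import Order.TTheory GRing.Theory Num.Theory.
Local Open Scope complex_scope.
Local Open Scope ring_scope.

(** Write E = (q;q)_oo.  Modulo 5, E^(5m+3) = (E^m)^5 E^3 is a power series in q^5
    times E^3, and by Jacobi's identity E^3 = sum_j (-1)^j (2j+1) q^(j(j+1)/2).
    The exponent j(j+1)/2 is never 2 or 4 modulo 5, and it is 3 modulo 5 only when
    5 divides 2j+1.

    Power series are handled as polynomials modulo 'X^n, E being congruent to
    E_n = prod_(k <= n) (1 - 'X^k) modulo 'X^n.+1.  The analytic hypothesis
    determines p modulo 'X^n because it gives an asymptotic expansion at 0+ along
    the reals, and such expansions are unique and multiplicative; in particular no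
    product of infinite series is needed. *)

Set Implicit Arguments.
Unset Strict Implicit.
Unset Printing Implicit Defensive.

(** * Truncated Euler products *)

Definition euler (A : nzRingType) (n : nat) : {poly A} :=
  \prod_(1 <= k < n.+1) (1 - 'X^k).

Lemma eulerS (A : nzRingType) n : euler A n.+1 = euler A n * (1 - 'X^(n.+1)).
Proof. by rewrite /euler big_nat_recr. Qed.

Lemma euler0 (A : nzRingType) : euler A 0 = 1.
Proof. by rewrite /euler big_geq. Qed.

Lemma map_euler (A B : nzRingType) (f : {rmorphism A -> B}) n :
  map_poly f (euler A n) = euler B n.
Proof.
elim: n => [|n IH]; first by rewrite !euler0 rmorph1.
by rewrite !eulerS rmorphM rmorphB rmorph1 /= map_polyXn IH.
Qed.

(** * Polynomials modulo a power of the variable *)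

(** The explicit cofactor lets the congruence be used over [int] as well as over fields, where
    [eqXP] turns it into divisibility. *)
Definition eqX (A : comNzRingType) (n : nat) (P Q : {poly A}) :=
  exists D, P = Q + D * 'X^n.

Section Congruence.
Variable A : comNzRingType.
Implicit Types P Q S : {poly A}.

Lemma eqX_refl n P : eqX n P P.
Proof. by exists 0; rewrite mul0r addr0. Qed.

Lemma eqX_sym n P Q : eqX n P Q -> eqX n Q P.
Proof. by move=> [D ->]; exists (- D); ring. Qed.

Lemma eqX_trans n P Q S : eqX n P Q -> eqX n Q S -> eqX n P S.
Proof. by move=> [D ->] [D' ->]; exists (D' + D); ring. Qed.

Lemma eqXM n P P' Q Q' : eqX n P P' -> eqX n Q Q' -> eqX n (P * Q) (P' * Q').
Proof. by move=> [D ->] [D' ->]; exists (P' * D' + D * Q' + D * D' * 'X^n); ring. Qed.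

Lemma eqX_exp n P Q k : eqX n P Q -> eqX n (P ^+ k) (Q ^+ k).
Proof.
move=> PQ; elim: k => [|k IH]; first exact: eqX_refl.
by rewrite !exprS; apply: eqXM.
Qed.

Lemma eqX_coef n P Q i : eqX n P Q -> (i < n)%N -> P`_i = Q`_i.
Proof. by move=> [D ->] ltin; rewrite coefD coefMXn ltin addr0. Qed.

(** Truncated geometric series: P = 1 - T with T a multiple of 'X, and (1 + T + ... + T^(n-1)) (1 -
    T) = 1 - T^n. *)
Lemma eqX_unit n P : P`_0 = 1 -> exists Q, eqX n (Q * P) 1.
Proof.
elim/poly_ind: P => [|P c _]; first by rewrite coef0 => /eqP; rewrite eq_sym oner_eq0.
rewrite coefD coefMX coefC /= add0r => ->.
exists (\sum_(i < n) (- (P * 'X)) ^+ i), (- (- P) ^+ n).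
set T := - (P * 'X); have -> : P * 'X + 1%:P = 1 - T by rewrite opprK addrC polyC1.
rewrite mulNr -exprMn mulNr -/T (canRL (subrK 1) (subrX1 T n)); ring.
Qed.
End Congruence.

Lemma eqX_map (A B : comNzRingType) (f : {rmorphism A -> B}) n P Q :
  eqX n P Q -> eqX n (map_poly f P) (map_poly f Q).
Proof.
move=> [D ->]; exists (map_poly f D).
by rewrite rmorphD rmorphM /= map_polyXn.
Qed.

Lemma eqXP (F : fieldType) n (P Q : {poly F}) :
  eqX n P Q <-> 'X^n %| P - Q.
Proof.
split=> [[D ->]|/dvdpP[D eD]]; first by rewrite addrC addKr dvdp_mulIr.
by exists D; rewrite -eD; ring.
Qed.

(** * A finite form of Jacobi's identity *)

Section Jacobi.
Variable F : fieldType.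
Local Notation E := (euler F).
Implicit Types u : nat -> {poly F}.

(* [jacobi n j] is q^(j(j+1)/2) times the Gaussian binomial [2n+1 choose n-j],
   i.e. the coefficient of z^(-j) and of z^(j+1) in
   (1+z) prod_(k <= n) (1 + z q^k)(1 + z^-1 q^k); the recursion is multiplication
   by the n-th factor.  At j = 0 the convention 0.-1 = 0 is the symmetry that
   exchanges z^(-j) and z^(j+1). *)
Fixpoint jacobi (n j : nat) : {poly F} :=
  if n is m.+1 then
    (1 + 'X^(2 * n)) * jacobi m j + 'X^n * (jacobi m j.-1 + jacobi m j.+1)
  else (j == 0)%:R.

(* These weights compute the derivative at z = -1, where the factor 1+z vanishes. *)
Definition jsign j : {poly F} := (-1) ^+ j * (2 * j + 1)%:R.

Lemma jacobi_gt n j : (n < j)%N -> jacobi n j = 0.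
Proof.
elim: n j => [|n IH] [|j] //= ltnj.
by rewrite !IH ?(mulr0, addr0) //; lia.
Qed.

(** Summation by parts, from jsign (j-1) + jsign (j+1) = -2 jsign j. At j = 0 the term [u 0.-1] =
    [u 0] plays the role of the missing neighbour, since jsign 0 + jsign 1 = -2. The last two terms
    are the boundary at k. *)
Lemma jsign_neighbours u k :
  \sum_(j < k.+1) jsign j * (u j.-1 + u j.+1) =
  - 2%:R * (\sum_(j < k.+1) jsign j * u j) - jsign k.+1 * u k + jsign k * u k.+1.
Proof.
rewrite /jsign; elim: k => [|k IH].
  by rewrite !big_ord1 /= expr1 !expr0 !natrD !natrM; ring.
rewrite big_ord_recr [in RHS]big_ord_recr /= IH !exprS !natrD !natrM -!natr1; ring.
Qed.

(** By [jsign_neighbours], passing from n-1 to n multiplies the sum by 1 + q^(2n) - 2 q^n = (1 -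
    q^n)^2; the boundary terms vanish by [jacobi_gt]. *)
Lemma jacobi_sum n k : (n < k)%N ->
  \sum_(j < k) jsign j * jacobi n j = E n ^+ 2.
Proof.
elim: n k => [|n IH] [|k] // ltnk.
  rewrite big_ord_recl big1 => [|i _]; last by rewrite /= mulr0.
  by rewrite /jsign euler0 /= !expr0 !mulr1 expr1n addr0.
under eq_bigr => j _ do rewrite /= mulrDr mulrCA [X in _ + X]mulrCA.
rewrite big_split -!mulr_sumr jsign_neighbours IH ?eulerS; last by lia.
rewrite !(@jacobi_gt n) //; last by lia.
by rewrite mulnC exprM /=; ring.
Qed.

Lemma tri_succ j : 'C(j.+2, 2) = ('C(j.+1, 2) + j.+1)%N.
Proof. by rewrite binS bin1. Qed.

(** The quotient formula for the Gaussian binomial, with denominators cleared; induction on n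
    through the three-term recursion. *)
Lemma jacobi_closed n j : (j <= n)%N ->
  jacobi n j * E (n - j) * E (n + j).+1 = 'X^('C(j.+1, 2)) * E (2 * n).+1.
Proof.
elim: n j => [|n IH] j lejn.
  have -> : j = 0%N by lia.
  by rewrite /= mul1r euler0 mul1r.
have dE : E (2 * n.+1).+1
   = E (2 * n).+1 * (1 - 'X^(2 * n.+1)) * (1 - 'X^((2 * n.+1).+1)).
  have e : (2 * n.+1)%N = (2 * n).+2 by lia.
  by rewrite eulerS {1}e eulerS -e.
pose a : {poly F} := 'X^(n.+1 - j); pose b : {poly F} := 'X^(n.+1 + j).
have dab : 'X^(2 * n.+1) = a * b by rewrite -exprD; congr (_ ^+ _); lia.
have dEb : E (n.+1 + j).+1 = E (n + j).+1 * (1 - 'X * b).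
  by rewrite eulerS -exprS addSn.
have t1 : jacobi n j * E (n.+1 - j) * E (n + j).+1
    = 'X^('C(j.+1, 2)) * E (2 * n).+1 * (1 - a).
  have [ltnj|lejn'] := ltnP n j.
    have -> : a = 1 by rewrite /a (_ : (n.+1 - j)%N = 0%N) //; lia.
    by rewrite jacobi_gt // subrr !(mul0r, mulr0).
  by rewrite -IH // /a subSn // eulerS; ring.
have t2 : 'X^(n.+1) * jacobi n j.-1 * E (n.+1 - j) * E (n.+1 + j).+1
    = 'X^('C(j.+1, 2)) * E (2 * n).+1 * a * (1 - b) * (1 - 'X * b).
  (* At j = 0 the predecessor is 0 itself and a = b, so [t1] gives the value. *)
  case: j lejn @a @b dab dEb t1 => [|j] lejn a b dab dEb t1.
    have ab : a = b by rewrite /a /b subn0 addn0.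
    have -> : 'X^(n.+1) = b by rewrite /b addn0.
    rewrite dEb /= -ab.
    transitivity (a * (1 - 'X * a) * (jacobi n 0 * E (n.+1 - 0) * E (n + 0).+1)).
      by ring.
    by rewrite t1; ring.
  have IHj := IH j (ltac:(lia)).
  have -> : 'X^('C(j.+2, 2)) * E (2 * n).+1 * a
      = 'X^(n.+1) * ('X^('C(j.+1, 2)) * E (2 * n).+1).
    have -> : 'X^(n.+1) = 'X^(j.+1) * a by rewrite -exprD; congr (_ ^+ _); lia.
    by rewrite tri_succ exprD; ring.
  rewrite -IHj /= dEb subSS addnS eulerS.
  have -> : 'X^((n + j).+2) = b by rewrite /b addSn addnS.
  by ring.
have t3 : 'X^(n.+1) * jacobi n j.+1 * E (n.+1 - j) * E (n + j).+1 * (1 - 'X * b)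
    = 'X^('C(j.+1, 2)) * E (2 * n).+1 * b * (1 - a) * ('X - a).
  (* In the first two cases [jacobi n j.+1] is 0, matched by the factor 1 - a, respectively 'X -
     a. *)
  have [eqj|[eqj|ltjn]] : (j = n.+1 \/ j = n \/ j < n)%N by lia.
  - have -> : a = 1 by rewrite /a eqj subnn.
    by rewrite jacobi_gt ?eqj // subrr !(mul0r, mulr0).
  - have -> : a = 'X by rewrite /a eqj subSnn.
    by rewrite jacobi_gt ?eqj // subrr !(mul0r, mulr0).
  have IHj := IH j.+1 ltjn.
  have IHj' : jacobi n j.+1 * E (n - j.+1) * (E (n + j).+1 * (1 - 'X * b))
      = 'X^('C(j.+1, 2)) * 'X^(j.+1) * E (2 * n).+1.
    by rewrite -exprD -tri_succ -IHj addnS -exprS addSn -eulerS.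
  pose c : {poly F} := 'X^(n - j.+1).
  have dEa : E (n.+1 - j) = E (n - j.+1) * (1 - c * 'X) * (1 - a).
    rewrite subSn ?eulerS; last by lia.
    by rewrite -(@subnSK j n) // eulerS /a /c -exprSr -!subSn ?subSS //; lia.
  have da : a = c * 'X^2 by rewrite -exprD; congr (_ ^+ _); lia.
  have db : 'X^(n.+1) * 'X^(j.+1) = 'X * b :> {poly F}.
    by rewrite -exprD -exprS; congr (_ ^+ _); lia.
  rewrite dEa.
  transitivity ('X^(n.+1) * (1 - c * 'X) * (1 - a) *
    (jacobi n j.+1 * E (n - j.+1) * (E (n + j).+1 * (1 - 'X * b)))); first by ring.
  rewrite IHj' (_ : _ * _ = 'X^(n.+1) * 'X^(j.+1) * ((1 - c * 'X) * (1 - a)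
       * 'X^('C(j.+1, 2)) * E (2 * n).+1)); last by ring.
  by rewrite db da; ring.
rewrite dE [('X^((2 * n.+1).+1))]exprS dab /= dab.
have -> : ((1 + a * b) * jacobi n j + 'X^(n.+1) * (jacobi n j.-1 + jacobi n j.+1))
     * E (n.+1 - j) * E (n.+1 + j).+1
  = (1 + a * b) * (jacobi n j * E (n.+1 - j) * E (n + j).+1) * (1 - 'X * b)
   + 'X^(n.+1) * jacobi n j.-1 * E (n.+1 - j) * E (n.+1 + j).+1
   + 'X^(n.+1) * jacobi n j.+1 * E (n.+1 - j) * E (n + j).+1 * (1 - 'X * b).
  by rewrite dEb; ring.
by rewrite t1 t2 t3; ring.
Qed.

Lemma coprime_Xn_euler k n : coprimep 'X^k (E n).
Proof.
apply: coprimep_expl; rewrite coprimep_sym.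
have := coprimep_XsubC (E n) 0; rewrite polyC0 subr0 => ->.
elim: n => [|n IH]; first by rewrite euler0 rootC oner_eq0.
by rewrite eulerS rootM negb_or IH /root !hornerE expr0n subr0 oner_eq0.
Qed.

Lemma eqX_euler n m : (n <= m)%N -> eqX n.+1 (E m) (E n).
Proof.
move=> lenm; apply/eqXP; elim: m lenm => [|m IH] lenm.
  by have -> : n = 0%N by [lia]; rewrite subrr dvdp0.
have [ltmn|lenm'] := ltnP m n.
  by have -> : n = m.+1 by [lia]; rewrite subrr dvdp0.
have -> : E m.+1 - E n = (E m - E n) - 'X^(m.+1) * E m by rewrite eulerS; ring.
by rewrite dvdp_sub ?IH // dvdp_mulr // dvdp_exp2l.
Qed.

(** All the Euler products in [jacobi_closed] agree with E n modulo 'X^(n-j+1), and they can be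
    cancelled, being coprime to 'X. The missing j powers of 'X come from 'C(j+1, 2) >= j. *)
Lemma eqX_euler_jacobi n j : (j <= n)%N ->
  eqX n.+1 (E n * jacobi n j) 'X^('C(j.+1, 2)).
Proof.
move=> lejn; apply/eqXP.
set A := E (n - j); set B := E (n + j).+1.
rewrite -(@Gauss_dvdpl _ _ (A * B)) ?coprimepMr ?coprime_Xn_euler //.
have -> : (E n * jacobi n j - 'X^('C(j.+1, 2))) * (A * B)
    = 'X^('C(j.+1, 2)) * ((E n - A) * E (2 * n).+1 + A * ((E (2 * n).+1 - A) - (B - A))).
  transitivity (E n * (jacobi n j * A * B) - 'X^('C(j.+1, 2)) * (A * B)); first by ring.
  by rewrite jacobi_closed //; ring.
apply: (@dvdp_trans _ ('X^('C(j.+1, 2)) * 'X^((n - j).+1))).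
  rewrite -exprD dvdp_exp2l //.
  have : (j <= 'C(j.+1, 2))%N by rewrite binS bin1 leq_addl.
  by lia.
rewrite dvdp_mul2l ?expf_neq0 ?polyX_eq0 //.
apply: dvdp_add; first by apply: dvdp_mulr; apply/eqXP; apply: eqX_euler; lia.
by apply: dvdp_mull; apply: dvdp_sub; apply/eqXP; apply: eqX_euler; lia.
Qed.

Lemma eqX_euler_cube n :
  eqX n.+1 (E n ^+ 3) (\sum_(j < n.+1) jsign j * 'X^('C(j.+1, 2))).
Proof.
apply/eqXP; rewrite [E n ^+ 3]exprS -(@jacobi_sum n n.+1) // mulr_sumr -sumrB.
elim/big_rec: _ => [|j P _ IH]; first by rewrite dvdp0.
rewrite dvdp_add // mulrCA -mulrBr dvdp_mull //.
by apply/eqXP; apply: eqX_euler_jacobi; have := ltn_ord j; lia.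
Qed.

End Jacobi.

(** * Reduction modulo 5 *)

Section ModFive.
Local Notation F5 := 'F_5.

Lemma pchar_polyF5 : 5 \in [pchar {poly F5}].
Proof. by rewrite pchar_poly pchar_Fp. Qed.

(** Additivity of the Frobenius map in characteristic 5. *)
Lemma exp5_comp (V : {poly F5}) : exists W, V ^+ 5 = W \Po 'X^5.
Proof.
elim/poly_ind: V => [|V c [W eW]]; first by exists 0; rewrite comp_poly0 expr0n.
exists (W * 'X + (c ^+ 5)%:P).
rewrite exprDn_pchar; last by rewrite (eq_pnat _ (pcharf_eq pchar_polyF5)) pnat_id.
by rewrite exprMn eW -polyC_exp comp_polyD comp_polyM comp_polyX comp_polyC.
Qed.

Lemma euler_cube_coef n i : (i <= n)%N -> (i %% 5 \in [:: 2; 3; 4])%N ->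
  (euler F5 n ^+ 3)`_i = 0.
Proof.
move=> lein; rewrite !inE => hi; rewrite (eqX_coef (eqX_euler_cube _ n)) //.
rewrite coef_sum big1 // => j _.
have -> : jsign F5 j = ((-1) ^+ j * (2 * j + 1)%:R)%:P.
  by rewrite polyCM rmorphXn rmorphN1 polyC_natr.
rewrite coefCM coefXn; case: eqP => [eij|]; last by rewrite mulr0.
rewrite mulr1; apply/eqP; rewrite mulf_eq0; apply/orP; right.
rewrite -(dvdn_pcharf (pchar_Fp (isT : prime 5))).
(* For j = 0, 1, 2, 3, 4 modulo 5 the triangular number is 0, 1, 3, 1, 0, so [hi] leaves only j = 2,
   where 5 divides 2j + 1. *)
have tri : ('C(j.+1, 2) * 2 = j.+1 * j)%N by rewrite mulnC -mul_bin_diag bin1.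
move: tri; rewrite -eij; move: (nat_of_ord j) => k.
have := divn_eq k 5; have := ltn_pmod k (isT : 0 < 5)%N.
move: (k %/ 5)%N (k %% 5)%N => q r ltr5 ->.
by case: r ltr5 => [|[|[|[|[|]]]]] // _; lia.
Qed.

(** The fifth power contributes only exponents j divisible by 5, so the index i - j left for the
    cube has the residue of i. *)
Lemma exp5_euler_cube_coef (P V : {poly F5}) i :
  (i %% 5 \in [:: 2; 3; 4])%N -> eqX i.+1 P (V ^+ 5 * euler F5 i ^+ 3) -> P`_i = 0.
Proof.
move=> hi /eqX_coef ->//; have [W ->] := exp5_comp V.
rewrite coefM big1 // => -[j ltj] _ /=.
rewrite coef_comp_poly_Xn //; case: ifP => [dvd5j|_]; last by rewrite mul0r.
rewrite euler_cube_coef ?mulr0 ?leq_subr //.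
by move: hi; rewrite !inE; lia.
Qed.

Lemma exp5_euler_cube_dvd (P V : {poly int}) i :
  (i %% 5 \in [:: 2; 3; 4])%N -> eqX i.+1 P (V ^+ 5 * euler int i ^+ 3) ->
  (P`_i = 0 %[mod 5])%Z.
Proof.
move=> hi /(eqX_map (intmul (1 : F5))).
rewrite rmorphM !rmorphXn /= map_euler => /(exp5_euler_cube_coef hi).
rewrite coef_map /= => /eqP; rewrite -(dvdz_pcharf (pchar_Fp (isT : prime 5))).
by move/dvdz_mod0P => ->.
Qed.

End ModFive.

Lemma euler_exp_dvd (m i : nat) : (i %% 5 \in [:: 2; 3; 4])%N ->
  ((euler int i ^+ (5 * m + 3))`_i = 0 %[mod 5])%Z.
Proof.
move=> hi; apply: (@exp5_euler_cube_dvd _ (euler int i ^+ m)) => //.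
by rewrite exprD mulnC exprM; apply: eqX_refl.
Qed.

(* Here [U] is D^(5m+2) with D the inverse of E; it is (D^(m+1))^5 E^3, the
   negative exponent -(5m+2) being -5(m+1)+3. *)
Lemma euler_expV_dvd (m i : nat) : (i %% 5 \in [:: 2; 3; 4])%N ->
  exists2 U, eqX i.+1 (U * euler int i ^+ (5 * m + 2)) 1
           & (U`_i = 0 %[mod 5])%Z.
Proof.
move=> hi; set E := euler int i.
have E0 : E`_0 = 1.
  rewrite /E; elim: (i) => [|k IH]; first by rewrite euler0 coef1.
  by rewrite eulerS mulrBr mulr1 coefB coefMXn IH subr0.
have [D DE] := eqX_unit i.+1 E0; exists (D ^+ (5 * m + 2)).
  by rewrite -exprMn -(expr1n _ (5 * m + 2)); apply: eqX_exp.
apply: (@exp5_euler_cube_dvd _ (D ^+ m.+1)) => //.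
rewrite -exprM (_ : (m.+1 * 5 = 5 * m + 2 + 3)%N); last by lia.
rewrite (exprD D (5 * m + 2) 3) -mulrA -exprMn -[X in eqX _ X]mulr1; apply: eqXM; first exact: eqX_refl.
by rewrite -(expr1n _ 3); apply/eqX_exp/eqX_sym.
Qed.

(** * Asymptotic expansions at 0+ *)

(* In a [numFieldType] such as R[i], [0 < t] forces [t] to be real. *)
Definition asymp (K : numFieldType) (N : nat) (f : K -> K) (P : {poly K}) :=
  exists M : K, forall t, 0 < t -> t < 4^-1 -> `|f t - P.[t]| <= M * t ^+ N.

Section Asymptotics.
Variable K : numFieldType.
Implicit Types (f g : K -> K) (P Q : {poly K}) (t : K).

Lemma lt4V_le1 t : t < 4^-1 -> t <= 1.
Proof.
by move=> /ltW/le_trans; apply; rewrite invf_le1 ?ltr0n // ler1n.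
Qed.

(** The bound at the single point 1/5 already forces M to be real and nonnegative. *)
Lemma asymp_ge0 N f P M :
  (forall t, 0 < t -> t < 4^-1 -> `|f t - P.[t]| <= M * t ^+ N) -> 0 <= M.
Proof.
have t0 : 0 < 5^-1 :> K by rewrite invr_gt0 ltr0n.
move=> /(_ 5^-1 t0); rewrite ltf_pV2 ?posrE ?ltr0n // ltr_nat => /(_ isT).
by move=> /(le_trans (normr_ge0 _)); rewrite pmulr_lge0 // exprn_gt0.
Qed.

Lemma horner_bounded P :
  exists M : K, forall t, 0 < t -> t < 4^-1 -> `|P.[t]| <= M.
Proof.
elim/poly_ind: P => [|P c [M PM]]; first by exists 0 => t _ _; rewrite horner0 normr0.
exists (M + `|c|) => t t0 t4; rewrite hornerMXaddC.
apply: (le_trans (ler_normD _ _)); rewrite lerD2r normrM (gtr0_norm t0).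
rewrite -[M]mulr1; apply: ler_pM; rewrite ?normr_ge0 ?(ltW t0) ?PM //.
exact: lt4V_le1.
Qed.

Lemma asympM N f g P Q :
  asymp N f P -> asymp N g Q -> asymp N (fun t => f t * g t) (P * Q).
Proof.
move=> [A fA] [B gB]; have [C PC] := horner_bounded P; have [D QD] := horner_bounded Q.
have A0 := asymp_ge0 fA; have B0 := asymp_ge0 gB.
exists (A * (B + D) + C * B) => t t0 t4; rewrite hornerM.
have -> : f t * g t - P.[t] * Q.[t]
    = (f t - P.[t]) * (g t - Q.[t] + Q.[t]) + P.[t] * (g t - Q.[t]) by ring.
apply: (le_trans (ler_normD _ _)); rewrite !normrM mulrDl; apply: lerD.
  rewrite mulrAC; apply: ler_pM; rewrite ?normr_ge0 ?fA //.
  apply: (le_trans (ler_normD _ _)); apply: lerD; rewrite ?QD //.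
  apply: (le_trans (gB t t0 t4)); rewrite -[leRHS]mulr1 ler_wpM2l //.
  by rewrite exprn_ile1 ?(ltW t0) ?lt4V_le1.
by rewrite -mulrA; apply: ler_pM; rewrite ?normr_ge0 ?PC ?gB.
Qed.

Lemma asympX N f P k : asymp N f P -> asymp N (fun t => f t ^+ k) (P ^+ k).
Proof.
move=> fP; elim: k => [|k IH].
  by exists 0 => t _ _; rewrite !expr0 hornerC subrr normr0 mul0r.
have [M PM] := asympM fP IH; exists M => t t0 t4.
by rewrite !exprS; apply: PM.
Qed.

Lemma small_eq0 (c M : K) :
  (forall t, 0 < t -> t < 4^-1 -> `|c| <= M * t) -> c = 0.
Proof.
move=> cM; apply/eqP; rewrite -normr_le0; apply/negP => /negP c0.
have {}c0 : 0 < `|c| by rewrite lt_neqAle normr_ge0 andbT eq_sym normr_eq0;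
  apply: contra c0 => /eqP ->; rewrite normr0.
have t5 : (5^-1 : K) < 4^-1 by rewrite ltf_pV2 ?posrE ?ltr0n // ltr_nat.
have t5p : 0 < 5^-1 :> K by rewrite invr_gt0 ltr0n.
have M0 : 0 < M.
  by have := lt_le_trans c0 (cM _ t5p t5); rewrite pmulr_lgt0.
pose t := `|c| / (M * 2 + `|c| * 5).
have d0 : 0 < M * 2 + `|c| * 5 by rewrite addr_gt0 // mulr_gt0 // ltr0n.
have tp : 0 < t by rewrite divr_gt0.
have t4 : t < 4^-1.
  apply: le_lt_trans t5; rewrite ler_pdivrMr // mulrDr [X in _ + X]mulrCA mulVf ?pnatr_eq0 // mulr1.
  by rewrite lerDr mulr_ge0 ?ltW // mulr_gt0 // ltr0n.
have := cM _ tp t4; rewrite /t mulrCA -[leLHS]mulr1 ler_pM2l // ler_pdivlMr // mul1r.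
apply/negP; rewrite lt_geF // -subr_gt0.
have -> : M * 2 + `|c| * 5 - M = M + `|c| * 5 by ring.
by rewrite addr_gt0 // mulr_gt0 // ltr0n.
Qed.

(** The constant coefficient is O(t), hence 0; dividing by t lowers N by one. *)
Lemma asymp0_eqX N P (M : K) :
  (forall t, 0 < t -> t < 4^-1 -> `|P.[t]| <= M * t ^+ N) -> eqX N P 0.
Proof.
elim: N P M => [|N IH] P M PM; first by exists P; rewrite add0r mulr1.
elim/poly_ind: P PM => [|P c _] PM; first exact: eqX_refl.
have [C PC] := horner_bounded P.
have M0 : 0 <= M.
  by apply: (@asymp_ge0 N.+1 (horner (P * 'X + c%:P)) 0 M) => t t0 t4;
    rewrite horner0 subr0; apply: PM.
have c0 : c = 0.
  apply: (@small_eq0 _ (M + C)) => t t0 t4.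
  have -> : c = (P * 'X + c%:P).[t] - P.[t] * t by rewrite hornerMXaddC; ring.
  apply: (le_trans (ler_normB _ _)); rewrite mulrDl lerD //.
    apply: (le_trans (PM t t0 t4)); rewrite exprSr mulrA ler_pM2r //.
    by rewrite -[leRHS]mulr1 ler_wpM2l // exprn_ile1 ?(ltW t0) ?lt4V_le1.
  by rewrite normrM (gtr0_norm t0) ler_pM2r // PC.
have [D eD] : eqX N P 0.
  apply: (IH _ M) => t t0 t4; have := PM t t0 t4.
  rewrite c0 addr0 hornerMX normrM (gtr0_norm t0) exprSr mulrA ler_pM2r //.
by exists D; rewrite c0 addr0 eD !add0r exprSr mulrA.
Qed.

Lemma asymp_unique N f P Q : asymp N f P -> asymp N f Q -> eqX N P Q.
Proof.
move=> [A fA] [B gB]; have [|D eD] := @asymp0_eqX N (P - Q) (A + B).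
  move=> t t0 t4; rewrite hornerD hornerN.
  have -> : P.[t] - Q.[t] = (f t - Q.[t]) - (f t - P.[t]) by ring.
  apply: (le_trans (ler_normB _ _)); rewrite addrC mulrDl.
  by apply: lerD; [apply: fA | apply: gB].
by exists D; rewrite -[X in _ + X]add0r -eD; ring.
Qed.

Lemma eq_asymp N f g P :
  (forall t, 0 < t -> t < 4^-1 -> f t = g t) -> asymp N f P -> asymp N g P.
Proof.
by move=> fg [M fM]; exists M => t t0 t4; rewrite -fg //; apply: fM.
Qed.

End Asymptotics.

(** * Convergence of the product and of the series *)

Section Analysis.
Import numFieldNormedType.Exports.
Local Open Scope classical_set_scope.
Variable R : realType.
Local Notation K := R[i].
Implicit Types (f : K -> K) (t : K).

Lemma cvg_norm_le (u : nat -> K) (l c b : K) N : u @ \oo --> l ->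
  (forall n, (N <= n)%N -> `|u n - c| <= b) -> `|l - c| <= b.
Proof.
move=> ul ub; have b0 : 0 <= b by apply: le_trans (ub N (leqnn N)).
rewrite real_leNgt ?normr_real ?ger0_real //; apply/negP => blc.
have e0 : 0 < `|l - c| - b by rewrite subr_gt0.
have /cvgrPdist_lt/(_ _ e0)[m _ um] := ul.
have := um (maxn m N) (leq_maxl _ _); apply/negP; rewrite -real_leNgt ?normr_real ?gtr0_real //.
rewrite lerBlDr; apply: (@le_trans _ _ (`|l - u (maxn m N)| + `|u (maxn m N) - c|)).
  by rewrite -[l - c](subrKA (u (maxn m N))) ler_normD.
by rewrite lerD2l ub ?leq_maxr.
Qed.

Lemma normrC (x : R) : `|x%:C| = `|x|%:C.
Proof. by rewrite normc_def /= expr0n addr0 sqrtr_sqr. Qed.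

Lemma cvg_realC (u : nat -> R) (l : R) :
  u @ \oo --> l -> (fun n => (u n)%:C) @ \oo --> l%:C.
Proof.
move=> /cvgrPdist_lt ul; apply/cvgrPdist_lt => e e0.
have eR : e = (complex.Re e)%:C by rewrite RRe_real ?gtr0_real.
have := ul (complex.Re e); rewrite -ltcR -eR => /(_ e0).
by apply: filterS => n; rewrite -rmorphB normrC eR ltcR.
Qed.

Definition qprod (x : R) n := \prod_(1 <= k < n.+1) (1 - x ^+ k).

Lemma qprodS x n : qprod x n.+1 = qprod x n * (1 - x ^+ n.+1).
Proof. by rewrite /qprod big_nat_recr. Qed.

Section Product.
Variable x : R.
Hypotheses (x0 : 0 < x) (x4 : x < 4^-1).

Let xn0 n : 0 < x ^+ n. Proof. exact: exprn_gt0. Qed.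
Let xn1 n : x ^+ n <= 1. Proof. by apply: exprn_ile1; move: x0 x4; lra. Qed.

Lemma qprod_itv n : 0 <= qprod x n <= 1.
Proof.
elim: n => [|n /andP[p0 p1]]; first by rewrite /qprod big_geq ?ler01 ?lexx.
have := xn0 n.+1; have := xn1 n.+1; rewrite qprodS => a b.
by apply/andP; split; nra.
Qed.

Lemma qprod_decr m n : (m <= n)%N -> qprod x n <= qprod x m.
Proof.
move=> /subnK <-; elim: (n - m)%N => [|k IH]; first exact: lexx.
rewrite addSn qprodS; have /andP[p0 _] := qprod_itv (k + m).
by have := xn0 (k + m).+1; nra.
Qed.

Lemma qprod_tail m n : (m <= n)%N -> qprod x m - 2 * x ^+ m.+1 <= qprod x n.
Proof.
move=> /subnK <-; set k := (n - m)%N.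
(* The added remainder makes the induction go through: with y = x^(k+m+1), a step lowers the product
   by at most y, while the remainder drops from 2y to 2xy <= y/2. *)
suff : qprod x m - 2 * x ^+ m.+1 + 2 * x ^+ (k + m).+1 <= qprod x (k + m).
  by have := xn0 (k + m).+1; lra.
elim: k => [|k IH]; first by rewrite subrK.
rewrite addSn qprodS; have /andP[_ p1] := qprod_itv (k + m).
have := xn0 (k + m).+1; rewrite (exprS _ (k + m).+1).
move: (x ^+ (k + m).+1) IH => y IH y0.
have : x * y <= 4^-1 * y by rewrite ler_pM2r ?ltW.
have : qprod x (k + m) * y <= 1 * y by rewrite ler_pM2r.
by lra.
Qed.

Lemma qprod_cvg : cvgn (qprod x).
Proof.
apply: nonincreasing_is_cvgn; first by move=> m n /qprod_decr.
by exists 0 => _ [n _ <-]; have /andP[] := qprod_itv n.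
Qed.

End Product.

Lemma lt4V_real t : 0 < t -> t < 4^-1 ->
  exists x : R, [/\ t = x%:C, 0 < x & x < 4^-1].
Proof.
move=> t0 t4; have tR : (complex.Re t)%:C = t by rewrite RRe_real ?gtr0_real.
exists (complex.Re t); split; rewrite // -ltcR tR //.
by rewrite fmorphV rmorph_nat.
Qed.

Lemma horner_eulerC (x : R) n : (euler K n).[x%:C] = (qprod x n)%:C.
Proof.
rewrite /euler horner_prod /qprod rmorph_prod; apply: eq_bigr => k _.
by rewrite !hornerE rmorphB rmorph1 rmorphXn.
Qed.

Lemma qpochhammer_cvg t : 0 < t -> t < 4^-1 ->
  (fun n => (euler K n).[t]) @ \oo --> qpochhammer t.
Proof.
move=> t0 t4; have [x [-> x0 x4]] := lt4V_real t0 t4.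
have eE : (fun n => (euler K n).[x%:C]) = (fun n => (qprod x n)%:C).
  by apply/funext => n; rewrite horner_eulerC.
have eP : (fun n => \prod_(1 <= k < n.+1) (1 - x%:C ^+ k)) = (fun n => (qprod x n)%:C).
  by apply/funext => n; rewrite /qprod rmorph_prod; apply: eq_bigr => k _;
    rewrite rmorphB rmorph1 rmorphXn.
by rewrite eE /qpochhammer eP; apply: cvgP (cvg_realC (qprod_cvg x0 x4)).
Qed.

Lemma qpochhammer_tail N t : 0 < t -> t < 4^-1 ->
  `|qpochhammer t - (euler K N).[t]| <= 2 * t ^+ N.+1.
Proof.
move=> t0 t4; apply: (cvg_norm_le (N := N) (qpochhammer_cvg t0 t4)) => n leNn.
have [x [-> x0 x4]] := lt4V_real t0 t4.
rewrite !horner_eulerC -rmorphB normrC -rmorphXn -(rmorph_nat (real_complex R)).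
rewrite -rmorphM lecR ler0_norm ?subr_le0 ?qprod_decr //.
by have := qprod_tail x0 x4 leNn; lra.
Qed.

Lemma qpochhammer_asymp N : asymp N.+1 (@qpochhammer R) (euler K N).
Proof. by exists 2; apply: qpochhammer_tail. Qed.

(** The tail bound at N = 0 puts the value within 2t < 1/2 of 1. *)
Lemma qpochhammer_neq0 t : 0 < t -> t < 4^-1 -> qpochhammer t != 0.
Proof.
move=> t0 t4; apply/eqP => g0; have := qpochhammer_tail 0 t0 t4.
rewrite g0 euler0 hornerC sub0r normrN normr1 expr1 => /le_lt_trans.
move=> /(_ (2 * 4^-1)); rewrite ltr_pM2l ?ltr0n // => /(_ t4).
by rewrite ltr_pdivlMr ?ltr0n // mul1r ltr_nat.
Qed.

Lemma series_asymp (p : nat -> K) f N :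
  (forall t, 0 < t -> t < 1 -> series (fun n => p n * t ^+ n) @ \oo --> f t) ->
  asymp N f (\poly_(i < N) p i).
Proof.
move=> pf; have h0 : 0 < 2^-1 :> K by rewrite invr_gt0 ltr0n.
have h1 : 2^-1 < 1 :> K by rewrite invf_lt1 ?ltr0n // ltr1n.
have [B B0 hB] : exists2 B : K, 0 < B & forall n, `|p n * 2^-1 ^+ n| <= B.
  have /cvg_series_cvg_0 p0 := cvgP _ (pf _ h0 h1).
  have /cvg_seq_bounded/pinfty_ex_gt0[B B0 pB] := cvgP _ p0.
  by exists B => // n; apply: pB.
have pB n : `|p n| <= B * 2 ^+ n.
  have := hB n; rewrite normrM (gtr0_norm (exprn_gt0 _ h0)) exprVn.
  by rewrite ler_pdivrMr // exprn_gt0 // ltr0n.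
exists (B * 2 ^+ N * 2) => t t0 t4.
have t1 : t < 1 by apply: lt_trans t4 _; rewrite invf_lt1 ?ltr0n // ltr1n.
have B1 k : 0 <= B * 2 ^+ N * t ^+ N * (2 * t) ^+ k.
  by rewrite !mulr_ge0 ?exprn_ge0 ?mulr_ge0 ?ltW // ltr0n.
apply: (cvg_norm_le (N := N) (pf t t0 t1)) => n /subnK <-.
(* The subtracted term makes the bound inductive: its growth at step k exceeds the new term's bound
   by a multiple of 1 - 4t, which is where t < 1/4 enters. *)
have : `|series (fun n => p n * t ^+ n) (n - N + N)%N - (\poly_(i < N) p i).[t]|
    <= B * 2 ^+ N * t ^+ N * (2 - 2 * (2 * t) ^+ (n - N)).
  elim: (n - N)%N => [|k IH].
    by rewrite horner_poly seriesEord /= subrr normr0 expr0 mulr1 subrr mulr0.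
  rewrite addSn seriesSr addrAC; apply: (le_trans (ler_normD _ _)).
  apply: (@le_trans _ _ (B * 2 ^+ N * t ^+ N * (2 - 2 * (2 * t) ^+ k)
      + B * 2 ^+ N * t ^+ N * (2 * t) ^+ k)).
    apply: lerD => //; rewrite normrM (gtr0_norm (exprn_gt0 _ t0)).
    rewrite (_ : _ * (2 * t) ^+ k = B * 2 ^+ (k + N) * t ^+ (k + N)).
      by rewrite ler_pM2r ?pB // exprn_gt0.
    by rewrite exprMn !exprD; ring.
  rewrite -subr_ge0.
  rewrite (_ : _ - _ = B * 2 ^+ N * t ^+ N * (2 * t) ^+ k * (1 - 4 * t)).
    by rewrite mulr_ge0 // subr_ge0 -ler_pdivlMl ?ltr0n // mulr1 ltW.
  by rewrite exprS; ring.
move=> /le_trans; apply; rewrite -subr_ge0.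
rewrite (_ : _ - _ = B * 2 ^+ N * t ^+ N * (2 * t) ^+ (n - N) * 2).
  by rewrite mulr_ge0 // ler0n.
by ring.
Qed.

(** * Identification of the coefficients with integers *)

Lemma partition_genfun_asymp (r : int) (p : nat -> K) N :
  partition_genfun r p ->
  asymp N (fun t => (qpochhammer t ^ r)^-1) (\poly_(i < N) p i).
Proof.
move=> pr; apply: series_asymp => t t0 t1; apply: pr.
by rewrite gtr0_norm.
Qed.

Lemma map_euler_int n k : map_poly intr (euler int n ^+ k) = euler K n ^+ k.
Proof. by rewrite rmorphXn /= map_euler. Qed.

Lemma partition_genfun_exp (s : nat) (p : nat -> K) i :
  partition_genfun (- s%:Z) p -> p i = ((euler int i ^+ s)`_i)%:~R.
Proof.
move=> pE; have pA := partition_genfun_asymp i.+1 pE.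
have gA := asympX s (@qpochhammer_asymp i).
have /eqX_coef/(_ (ltnSn i)) : eqX i.+1 (\poly_(i < i.+1) p i) (euler K i ^+ s).
  apply: (asymp_unique _ gA); apply: eq_asymp pA => t _ _.
  by rewrite -invr_expz invrK.
by rewrite coef_poly ltnSn -map_euler_int coef_map.
Qed.

(** The truncated series and U are both inverse to E^s modulo 'X^(i+1): the first because its
    asymptotic product with E^s is that of the constant function 1. Hence they agree. *)
Lemma partition_genfun_expV (s : nat) (p : nat -> K) i U :
  partition_genfun s%:Z p -> eqX i.+1 (U * euler int i ^+ s) 1 ->
  p i = (U`_i)%:~R.
Proof.
move=> pE /(eqX_map (intmul (1 : K))).
rewrite rmorphM rmorph1 /= map_euler_int => UE.
have pA := partition_genfun_asymp i.+1 pE.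
have gA := asympX s (@qpochhammer_asymp i).
have oneA : asymp i.+1 (fun t : K => 1) 1.
  by exists 0 => t _ _; rewrite hornerC subrr normr0 mul0r.
have P1 : eqX i.+1 (\poly_(i < i.+1) p i * euler K i ^+ s) 1.
  apply: (asymp_unique _ oneA); apply: eq_asymp (asympM pA gA) => t t0 t4.
  by rewrite mulVf // expf_neq0 // qpochhammer_neq0.
have /eqX_coef/(_ (ltnSn i)) : eqX i.+1 (\poly_(i < i.+1) p i) (map_poly intr U).
  rewrite -[X in eqX _ X]mulr1 -[X in eqX _ _ X]mulr1.
  apply: eqX_trans (eqXM (eqX_refl _ _) (eqX_sym UE)) _.
  by rewrite mulrCA; apply: eqXM P1; apply: eqX_refl.
by rewrite coef_poly ltnSn coef_map.
Qed.

End Analysis.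

Theorem theorem1p2 (R : realType) (p : int -> nat -> R[i])
    (hp : forall r : int, r != 0 -> partition_genfun r (p r))
    (lambda : int) (n l : nat) (hl : (l \in [:: 2; 3; 4])%N) :
  exists2 m : int,
    p (- (5 * lambda + 3)) (5 * n + l)%N = m%:~R & (m = 0 %[mod 5])%Z.
Proof.
have hi : ((5 * n + l) %% 5 \in [:: 2; 3; 4])%N.
  by move: hl; rewrite !inE; lia.
have r0 : - (5 * lambda + 3) != 0 by lia.
(* For lambda = m >= 0 the generating function is E^(5m+3); for lambda = -(m+1) it is the inverse of
   E^(5m+2). *)
have := hp _ r0; case: lambda {r0} => m.
  rewrite (_ : 5 * Posz m + 3 = (5 * m + 3)%N%:Z); last by lia.
  move=> /partition_genfun_exp pE.
  by exists ((euler int (5 * n + l) ^+ (5 * m + 3))`_(5 * n + l)) => //;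
    apply: euler_exp_dvd.
rewrite (_ : - (5 * Negz m + 3) = (5 * m + 2)%N%:Z); last by lia.
have [U UE U5] := euler_expV_dvd m hi.
by move=> /partition_genfun_expV pE; exists U`_(5 * n + l) => //; apply: pE.
Qed.
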